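(* Let $\Gamma$ be an abelian group and let $A$ be a $\Gamma$-graded local ring. Then there is a $\mathbb{Z}[\Gamma]$-module isomorphism $$K_0^{\mathrm{gr}}(A)\;\cong\;\mathbb{Z}[\Gamma/\Gamma_A^*].$$
   Context: Rings have identity; modules are right modules. A $\Gamma$-graded ring $A$ (not necessarily commutative) is graded local if the two-sided ideal generated by the noninvertible homogeneous elements is a proper ideal. $\Gamma_A^*=\{\alpha\in\Gamma: A_\alpha \text{ contains an invertible element of } A\}$, a subgroup of $\Gamma$. $K_0^{\mathrm{gr}}(A)$ is the group completion of the monoid (under $\oplus$) of graded isomorphism classes $[P]$ of graded finitely generated projective right $A$-modules, with $\mathbb{Z}[\Gamma]$-module structure $\alpha[P]=[P(\alpha)]$, where $P(\alpha)_\gamma=P_{\alpha+\gamma}$. $\mathbb{Z}[\Gamma/\Gamma_A^*]$ has its natural $\mathbb{Z}[\Gamma]$-module structure. *)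

(* Defs.v *)
From HB Require Import structures.
From mathcomp Require Import all_boot all_algebra.
From mathcomp Require Import boolp classical_sets.
From mathcomp Require Import freeg.

Set Implicit Arguments.
Unset Strict Implicit.
Unset Printing Implicit Defensive.

Import GRing.Theory.
Local Open Scope ring_scope.
Local Open Scope classical_set_scope.
Local Open Scope quotient_scope.

(* [V_] exhibits [V] as the internal direct sum of the additive subgroups
   [V_ g], g in G. *)
Definition is_grading (G V : zmodType) (V_ : G -> set V) : Prop :=
  [/\ forall g, V_ g 0 /\ (forall x y, V_ g x -> V_ g y -> V_ g (x - y)),
      forall v : V, exists2 s : seq V,
        (forall x, x \in s -> exists g, V_ g x) & v = \sum_(x <- s) x
    & forall (s : seq G) (f : G -> V), uniq s -> (forall g, V_ g (f g)) ->
        \sum_(g <- s) f g = 0 -> forall g, g \in s -> f g = 0].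

Record gradedRing (G : zmodType) := GradedRing {
  gr_ring :> pzRingType;
  homog : G -> set gr_ring;
  homog_grading : is_grading homog;
  homogM : forall g h a b, homog g a -> homog h b -> homog (g + h) (a * b)
}.

Definition invertible (R : pzRingType) (a : R) : Prop :=
  exists b : R, a * b = 1 /\ b * a = 1.

Definition two_sided_ideal (R : pzRingType) (I : set R) : Prop :=
  [/\ I 0, forall x y, I x -> I y -> I (x - y)
    & forall a x, I x -> I (a * x) /\ I (x * a)].

Definition graded_local (G : zmodType) (A : gradedRing G) : Prop :=
  smallest (@two_sided_ideal A)
    [set a | (exists g, homog g a) /\ ~ invertible a] <> setT.

Lemma sum_supp (I : eqType) (V : nmodType) (s t : seq I) (f : I -> V) :
  uniq s -> uniq t -> {subset s <= t} -> (forall i, i \notin s -> f i = 0) ->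
  \sum_(i <- t) f i = \sum_(i <- s) f i.
Proof.
move=> us ut st f0; rewrite (bigID (mem s)) /= [X in _ + X]big1 // addr0.
rewrite -big_filter; apply: perm_big; apply: uniq_perm; rewrite ?filter_uniq //.
by move=> i; rewrite mem_filter; apply: andb_idr; apply: st.
Qed.

Section UnitSupport.
Variables (G : zmodType) (A : gradedRing G).

Definition unit_support : {pred G} :=
  fun g => `[< exists2 a : A, homog g a & invertible a >].

Lemma homog0 (g : G) : homog g (0 : A).
Proof. by have [/(_ g)[]] := homog_grading A. Qed.

Lemma homogB (g : G) (x y : A) : homog g x -> homog g y -> homog g (x - y).
Proof. by have [/(_ g)[_ +] _ _] := homog_grading A; apply. Qed.

Lemma homogN (g : G) (x : A) : homog g x -> homog g (- x).
Proof. by move=> hx; rewrite -sub0r; apply: homogB => //; apply: homog0. Qed.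

Lemma homogD (g : G) (x y : A) : homog g x -> homog g y -> homog g (x + y).
Proof. by move=> hx hy; rewrite -[y]opprK; apply: homogB => //; apply: homogN. Qed.

Lemma homog_sum (g : G) (I : Type) (r : seq I) (F : I -> A) :
  (forall i, homog g (F i)) -> homog g (\sum_(i <- r) F i).
Proof.
by move=> hF; elim/big_ind: _ => [|x y|i _] //; [apply: homog0|apply: homogD].
Qed.

Lemma homog_decomp (a : A) : exists (s : seq G) (f : G -> A),
  [/\ uniq s, forall g, homog g (f g), forall g, g \notin s -> f g = 0
    & a = \sum_(g <- s) f g].
Proof.
have [_ /(_ a)[r hr ->] _] := homog_grading A.
elim: r hr => [|x r IHr] hr.
  exists [::], (fun=> 0); split=> //; last by rewrite !big_nil.
  by move=> g; apply: homog0.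
have /IHr[s [f [us hf f0 E]]] : forall y, y \in r -> exists g, homog g y.
  by move=> y yr; apply: hr; rewrite inE yr orbT.
have [g hg] : exists g, homog g x by apply: hr; rewrite inE eqxx.
pose f' h := f h + (if h == g then x else 0); pose t := undup (g :: s).
have ut : uniq t by apply: undup_uniq.
have gt : g \in t by rewrite mem_undup mem_head.
have st : {subset s <= t} by move=> h hs; rewrite mem_undup inE hs orbT.
exists t, f'; split=> //.
- move=> h; apply: homogD => //; case: eqP => [->//|_]; exact: homog0.
- move=> h; rewrite mem_undup inE negb_or => /andP[/negPf hg' hs].
  by rewrite /f' hg' f0 // addr0.
rewrite big_cons E /f' big_split [LHS]addrC -(sum_supp us ut st f0) /=.
rewrite [X in _ = _ + X](bigD1_seq g) //= eqxx.
by rewrite [X in _ + (_ + X)]big1 ?addr0 // => h /negPf ->.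
Qed.

Lemma homog_indep (s : seq G) (f : G -> A) :
  uniq s -> (forall g, homog g (f g)) -> \sum_(g <- s) f g = 0 ->
  forall g, g \in s -> f g = 0.
Proof. by have [_ _] := homog_grading A; apply. Qed.

Lemma homog_divl (g k : G) (x y b : A) (s : seq G) (f : G -> A) :
  homog g x -> homog k y -> uniq s -> (forall h, homog h (f h)) ->
  (forall h, h \notin s -> f h = 0) -> b = \sum_(h <- s) f h ->
  x * b = y -> x * f (k - g) = y.
Proof.
move=> hx hy us hf f0 Eb xb.
pose F h := x * f (h - g) - (if h == k then y else 0).
have hF h : homog h (F h).
  apply: homogB; last by case: eqP => [->//|_]; apply: homog0.
  by rewrite -{1}(subrK g h) addrC; apply: homogM.
pose t := undup (k :: [seq g + h | h <- s]).
have ut : uniq t by apply: undup_uniq.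
have kt : k \in t by rewrite mem_undup mem_head.
have um : uniq [seq g + h | h <- s] by rewrite map_inj_uniq //; apply: addrI.
have mt : {subset [seq g + h | h <- s] <= t}.
  by move=> h hs; rewrite mem_undup inE hs orbT.
have S : \sum_(h <- t) F h = 0.
  rewrite sumrB [X in _ - X](bigD1_seq k) //= eqxx.
  rewrite [X in _ - (_ + X)]big1 ?addr0; last by move=> h /negPf ->.
  rewrite (sum_supp um ut mt) => [|h hs].
    rewrite big_map; under eq_bigr => h _ do rewrite addrAC subrr add0r.
    by rewrite -mulr_sumr -Eb xb subrr.
  rewrite f0 ?mulr0 //; apply: contra hs => hs; apply/mapP.
  by exists (h - g) => //; rewrite addrC subrK.
have := homog_indep ut hF S kt.
by rewrite /F eqxx => /subr0_eq.
Qed.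

Lemma homog1 : homog 0 (1 : A).
Proof.
have [s [f [us hf f0 E1]]] := homog_decomp (1 : A).
have f00 g x : homog g x -> x * f 0 = x.
  move=> hx; rewrite -(subrr g).
  by apply: (homog_divl hx hx us hf f0 E1); rewrite mulr1.
suff -> : (1 : A) = f 0 by [].
rewrite -[RHS]mul1r [X in X * _]E1 mulr_suml E1.
by apply: eq_bigr => g _; rewrite (f00 g).
Qed.

Lemma unit_support_zmod_closed : zmod_closed unit_support.
Proof.
split.
  by apply/asboolP; exists 1; [exact: homog1|exists 1; rewrite mulr1].
suff invg g (a : A) : homog g a -> invertible a ->
    exists2 b : A, homog (- g) b & a * b = 1 /\ b * a = 1.
  move=> g h /asboolP[a ga [a' [aa' a'a]]] /asboolP[b hb bi].
  have [b' hb' [bb' b'b]] := invg _ _ hb bi.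
  apply/asboolP; exists (a * b'); first exact: homogM.
  exists (b * a'); split.
    by rewrite mulrA -[a * b' * b]mulrA b'b mulr1.
  by rewrite mulrA -[b * a' * a]mulrA a'a mulr1.
move=> ga [b [ab ba]].
have [s [f [us hf f0 Eb]]] := homog_decomp b.
suff E1 : a * f (- g) = 1.
  have bE : b = f (- g) by rewrite -[LHS]mulr1 -E1 mulrA ba mul1r.
  by exists b; rewrite // bE.
by rewrite -[- g]sub0r; apply: (homog_divl ga homog1 us hf f0 Eb).
Qed.

HB.instance Definition _ :=
  GRing.isZmodClosed.Build G unit_support unit_support_zmod_closed.

End UnitSupport.

Section FreeExtension.
Variables (K : choiceType) (M : zmodType).

Definition fgext (f : K -> M) (r : {freeg K / int}) : M :=
  \sum_(x <- dom r) f x *~ coeff x r.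

Lemma fgextE f r s : uniq s -> {subset dom r <= s} ->
  fgext f r = \sum_(x <- s) f x *~ coeff x r.
Proof.
move=> us rs; rewrite (sum_supp (uniq_dom r) us rs) // => x xr.
by rewrite coeff_outdom // mulr0z.
Qed.

Lemma fgextD f : {morph fgext f : r s / r + s}.
Proof.
move=> r s; pose t := undup (dom r ++ dom s ++ dom (r + s)).
have ut : uniq t by apply: undup_uniq.
rewrite !(@fgextE f _ t) // => [|x xr|x xr|x xr];
  rewrite ?mem_undup ?mem_cat ?xr ?orbT //.
by rewrite -big_split; apply: eq_bigr => x _; rewrite coeffD mulrzDr.
Qed.

Lemma fgextU f k x : fgext f << k *g x >> = f x *~ k.
Proof.
have [->|k0] := eqVneq k 0; first by rewrite freegU0 /fgext dom0 big_nil.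
by rewrite /fgext domU // big_seq1 coeffU eqxx mulr1.
Qed.

Lemma fgext_sum f (I : Type) (s : seq I) (F : I -> {freeg K / int}) :
  fgext f (\sum_(i <- s) F i) = \sum_(i <- s) fgext f (F i).
Proof.
apply: (big_morph (fgext f) (fgextD f)).
by rewrite /fgext dom0 big_nil.
Qed.

Lemma fgext_add f g r : fgext (fun x => f x + g x) r = fgext f r + fgext g r.
Proof. by rewrite -big_split; apply: eq_bigr => x _; rewrite mulrzDl. Qed.

Lemma eq_fgext f g r : f =1 g -> fgext f r = fgext g r.
Proof. by move=> fg; apply: eq_bigr => x _; rewrite fg. Qed.

Lemma fg_ext (F H : {freeg K / int} -> M) :
  {morph F : x y / x + y} -> {morph H : x y / x + y} ->
  (forall x, F << x >> = H << x >>) -> F =1 H.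
Proof.
move=> FD HD FH r.
have add0 (f : {freeg K / int} -> M) : {morph f : x y / x + y} -> f 0 = 0.
  by move=> fD; apply: (addIr (f 0)); rewrite -fD !add0r.
have F0 := add0 _ FD; have H0 := add0 _ HD.
have addN (f : {freeg K / int} -> M) : {morph f : x y / x + y} ->
    forall x, f (- x) = - f x.
  by move=> fD x; apply: (addrI (f x)); rewrite -fD !subrr add0.
have FHn n x : F << n%:Z *g x >> = H << n%:Z *g x >>.
  elim: n => [|n IHn]; first by rewrite freegU0 F0 H0.
  by rewrite -addn1 PoszD -freegUD FD HD IHn FH.
rewrite -[r]freeg_sumE (big_morph F FD F0) (big_morph H HD H0).
apply: eq_bigr => x _; case: (coeff x r) => n; first exact: FHn.
by rewrite NegzE -freegUN addN // addN // FHn.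
Qed.

End FreeExtension.

Lemma fgext_morph (K : choiceType) (M N : zmodType) (F : M -> N) (f : K -> M) r :
  {morph F : x y / x + y} -> F (fgext f r) = fgext (F \o f) r.
Proof.
move=> FD; move: r; apply: fg_ext => [x y|x y|x] /=.
- by rewrite fgextD FD.
- by rewrite fgextD.
- by rewrite !fgextU !mulr1z.
Qed.

(* The group ring Z[G]: the free abelian group on G, with basis elements
   << g >>, multiplied by << g >> * << h >> = << g + h >>. *)
Definition zgr (G : zmodType) : Type := {freeg G / int}.
HB.instance Definition _ (G : zmodType) := GRing.Zmodule.on (zgr G).

Section GroupRing.
Variable G : zmodType.
Implicit Types (x y z : zgr G) (g h : G).

Definition zgr_shift g : zgr G -> zgr G := fgext (fun h => << g + h >> : zgr G).
Definition zgr_one : zgr G := << 0 >>.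
Definition zgr_mul x y : zgr G := fgext (zgr_shift^~ y) x.

Lemma zgr_shiftD g : {morph zgr_shift g : x y / x + y}.
Proof. exact: fgextD. Qed.

Lemma zgr_shiftU g h : zgr_shift g << h >> = << g + h >>.
Proof. by rewrite /zgr_shift fgextU mulr1z. Qed.

Lemma zgr_shift0 : zgr_shift 0 =1 id.
Proof.
by apply: fg_ext => [||h] //; rewrite ?zgr_shiftU ?add0r //; apply: zgr_shiftD.
Qed.

Lemma zgr_shiftA g h x : zgr_shift (g + h) x = zgr_shift g (zgr_shift h x).
Proof.
move: x; apply: fg_ext => [|x y|k]; first exact: zgr_shiftD.
  by rewrite !zgr_shiftD.
by rewrite !zgr_shiftU addrA.
Qed.

Lemma zgr_mulDl : left_distributive zgr_mul +%R.
Proof. by move=> x y z; rewrite /zgr_mul fgextD. Qed.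

Lemma zgr_mulDr x : {morph zgr_mul x : y z / y + z}.
Proof.
move=> y z; rewrite /zgr_mul -fgext_add; apply: eq_fgext => g.
exact: zgr_shiftD.
Qed.

Lemma zgr_mulUl g y : zgr_mul << g >> y = zgr_shift g y.
Proof. by rewrite /zgr_mul fgextU mulr1z. Qed.

Lemma zgr_mulUU g h : zgr_mul << g >> << h >> = << g + h >>.
Proof. by rewrite zgr_mulUl zgr_shiftU. Qed.

Lemma zgr_mul1 : left_id zgr_one zgr_mul.
Proof. by move=> x; rewrite zgr_mulUl zgr_shift0. Qed.

Lemma zgr_mulC : commutative zgr_mul.
Proof.
move=> x y; move: x.
apply: fg_ext => [x z|x z|g]; [exact: zgr_mulDl|exact: zgr_mulDr|].
move: y; apply: fg_ext => [x z|x z|h]; [exact: zgr_mulDr|exact: zgr_mulDl|].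
by rewrite !zgr_mulUU addrC.
Qed.

Lemma zgr_mulA : associative zgr_mul.
Proof.
move=> x y z; move: x.
apply: fg_ext => [u v|u v|g]; rewrite ?zgr_mulDl // !zgr_mulUl.
move: y; apply: fg_ext => [u v|u v|h].
- by rewrite zgr_mulDl zgr_shiftD.
- by rewrite zgr_shiftD zgr_mulDl.
- by rewrite zgr_shiftU !zgr_mulUl zgr_shiftA.
Qed.

Lemma zgr_one_neq0 : zgr_one != 0.
Proof. by rewrite /zgr_one freegU_eq0. Qed.

HB.instance Definition _ := GRing.Zmodule_isComNzRing.Build (zgr G)
  zgr_mulA zgr_mulC zgr_mul1 zgr_mulDl zgr_one_neq0.

End GroupRing.

(* An abelian group with an additive action of G is a Z[G]-module, on which
   << g >> acts as g. *)
Section GroupRingModule.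
Variables (G M : zmodType) (act : G -> M -> M).
Hypothesis actD : forall g, {morph act g : x y / x + y}.
Hypothesis act0 : act 0 =1 id.
Hypothesis actA : forall g h x, act (g + h) x = act g (act h x).

Definition zgr_scale (r : zgr G) (x : M) : M := fgext (act^~ x) r.

Lemma zgr_scaleU g x : zgr_scale << g >> x = act g x.
Proof. by rewrite /zgr_scale fgextU mulr1z. Qed.

Lemma zgr_scaleDl x : {morph zgr_scale^~ x : r s / r + s}.
Proof. by move=> r s; apply: fgextD. Qed.

Lemma zgr_scaleDr : right_distributive zgr_scale +%R.
Proof.
by move=> r x y; rewrite /zgr_scale -fgext_add; apply: eq_fgext => g; apply: actD.
Qed.

Lemma zgr_scale1 : left_id 1 zgr_scale.
Proof. by move=> x; rewrite zgr_scaleU act0. Qed.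

Lemma zgr_scaleA r s x : zgr_scale r (zgr_scale s x) = zgr_scale (r * s) x.
Proof.
move: r; apply: fg_ext => [u v|u v|g].
- exact: zgr_scaleDl.
- by rewrite mulrDl; apply: zgr_scaleDl.
rewrite zgr_scaleU; move: s; apply: fg_ext => [u v|u v|h].
- by rewrite zgr_scaleDl actD.
- by rewrite mulrDr zgr_scaleDl.
- by rewrite [_ * _]zgr_mulUU !zgr_scaleU actA.
Qed.

End GroupRingModule.

(* Z[G/H] as a Z[G]-module, g acting as translation by the class of g. *)
Section GroupRingQuotient.
Variables (G : zmodType) (H : zmodClosed G).

Definition zgr_quot : Type := zgr (Quotient.quot H).
HB.instance Definition _ := GRing.Zmodule.on zgr_quot.

Definition zgr_quot_act (g : G) (x : zgr_quot) : zgr_quot :=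
  zgr_shift (\pi_(Quotient.quot H) g) x.

Lemma zgr_quot_actD g : {morph zgr_quot_act g : x y / x + y}.
Proof. exact: zgr_shiftD. Qed.

Lemma zgr_quot_act0 : zgr_quot_act 0 =1 id.
Proof. by move=> x; rewrite /zgr_quot_act raddf0; apply: zgr_shift0. Qed.

Lemma zgr_quot_actA g h x :
  zgr_quot_act (g + h) x = zgr_quot_act g (zgr_quot_act h x).
Proof. by rewrite /zgr_quot_act raddfD; apply: zgr_shiftA. Qed.

HB.instance Definition _ := GRing.Zmodule_isLmodule.Build (zgr G) zgr_quot
  (zgr_scaleA zgr_quot_actD zgr_quot_actA) (zgr_scale1 zgr_quot_act0)
  (zgr_scaleDr zgr_quot_actD) (zgr_scaleDl zgr_quot_act).

End GroupRingQuotient.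

(* The group completion of a commutative monoid M: pairs (a, b), standing for
   a - b, modulo (a, b) ~ (c, d) iff a + d + k = c + b + k for some k. *)
Section GroupCompletion.
Variable M : nmodType.
Implicit Types p q : M * M.

Definition gcompl_rel p q : bool :=
  `[< exists k, p.1 + q.2 + k = q.1 + p.2 + k >].

Lemma gcompl_rel_equiv : equiv_class_of gcompl_rel.
Proof.
split=> [p|p q|q p r]; first by apply/asboolP; exists 0.
  by apply: asbool_equiv_eq; split=> -[k ek]; exists k.
move=> /asboolP[k ek] /asboolP[l el]; apply/asboolP.
exists (q.1 + q.2 + k + l).
rewrite [LHS](AC (2*4) ((1*4*5)*(3*2*6))) /= ek el.
by rewrite [LHS](AC (3*3) ((4*2)*(1*5*3*6))) /=.
Qed.

Canonical gcompl_equiv := EquivRelPack gcompl_rel_equiv.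
Canonical gcompl_encModRel := defaultEncModRel gcompl_rel.

Definition gcompl : Type := {eq_quot gcompl_rel}.
HB.instance Definition _ : EqQuotient _ gcompl_rel gcompl :=
  EqQuotient.on gcompl.
HB.instance Definition _ := Choice.on gcompl.

Definition gsub (a b : M) : gcompl := \pi_gcompl (a, b).
Definition gclass (a : M) : gcompl := gsub a 0.

Lemma gsubP a b c d :
  gsub a b = gsub c d <-> exists k, a + d + k = c + b + k.
Proof.
split; first by move=> /eqmodP /asboolP.
by move=> e; apply/eqmodP/asboolP.
Qed.

Lemma gsub_surj u : exists a b, u = gsub a b.
Proof. by elim/quotW: u => -[a b]; exists a, b. Qed.

Definition gc_add (u v : gcompl) : gcompl :=
  gsub ((repr u).1 + (repr v).1) ((repr u).2 + (repr v).2).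
Definition gc_opp (u : gcompl) : gcompl := gsub (repr u).2 (repr u).1.

Lemma repr_gsub a b : exists k, (repr (gsub a b)).1 + b + k = a + (repr (gsub a b)).2 + k.
Proof.
apply/gsubP; rewrite -[RHS]reprK; congr (\pi_gcompl _).
by case: repr.
Qed.

Lemma gc_addE a b c d : gc_add (gsub a b) (gsub c d) = gsub (a + c) (b + d).
Proof.
have [k ek] := repr_gsub a b; have [l el] := repr_gsub c d.
apply/gsubP; exists (k + l).
rewrite [LHS](AC (2*2*2) ((1*3*5)*(2*4*6))) /= ek el.
by rewrite [LHS](AC (3*3) ((1*4)*(2*5)*(3*6))) /=.
Qed.

Lemma gc_oppE a b : gc_opp (gsub a b) = gsub b a.
Proof.
have [k ek] := repr_gsub a b.
by apply/gsubP; exists k; rewrite [in LHS](addrC _ a) -ek addrC [b + _]addrC addrC.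
Qed.

Lemma gc_addA : associative gc_add.
Proof.
move=> u v w; have [a [b ->]] := gsub_surj u; have [c [d ->]] := gsub_surj v.
by have [e [f ->]] := gsub_surj w; rewrite !gc_addE !addrA.
Qed.

Lemma gc_addC : commutative gc_add.
Proof.
move=> u v; have [a [b ->]] := gsub_surj u; have [c [d ->]] := gsub_surj v.
by rewrite !gc_addE (addrC a) (addrC b).
Qed.

Lemma gc_add0 : left_id (gsub 0 0) gc_add.
Proof. by move=> u; have [a [b ->]] := gsub_surj u; rewrite gc_addE !add0r. Qed.

Lemma gc_addN : left_inverse (gsub 0 0) gc_opp gc_add.
Proof.
move=> u; have [a [b ->]] := gsub_surj u; rewrite gc_oppE gc_addE.
by apply/gsubP; exists 0; rewrite !addr0 add0r addrC.
Qed.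

HB.instance Definition _ := GRing.isZmodule.Build gcompl
  gc_addA gc_addC gc_add0 gc_addN.

Lemma gsubD a b c d : gsub a b + gsub c d = gsub (a + c) (b + d).
Proof. exact: gc_addE. Qed.

End GroupCompletion.

Definition gcompl_map (M N : nmodType) (f : M -> N) (u : gcompl M) : gcompl N :=
  gsub (f (repr u).1) (f (repr u).2).

Lemma gcompl_mapE (M N : nmodType) (f : M -> N) a b :
  {morph f : x y / x + y} -> gcompl_map f (gsub a b) = gsub (f a) (f b).
Proof.
move=> fD; have [k ek] := repr_gsub a b.
by apply/gsubP; exists (f k); rewrite -!fD ek.
Qed.

(* Right A-modules are left modules over the opposite ring A^c: x a is written
   (a : A^c) *: x. *)
Record gradedModule (G : zmodType) (A : gradedRing G) := GradedModule {
  gm_sort :> lmodType A^c;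
  gm_homog : G -> set gm_sort;
  gm_grading : is_grading gm_homog;
  gm_homogM : forall g h (x : gm_sort) (a : A),
    gm_homog g x -> homog h a -> gm_homog (g + h) ((a : A^c) *: x)
}.

Section GradedModules.
Variables (G : zmodType) (A : gradedRing G).
Implicit Types M N P Q : gradedModule A.

Definition graded_hom M N (f : M -> N) : Prop :=
  forall g x, gm_homog g x -> gm_homog g (f x).

Definition graded_iso M N : Prop :=
  exists (f : {linear M -> N}) (f' : {linear N -> M}),
    [/\ graded_hom f, graded_hom f', cancel f f' & cancel f' f].

(* s_0 a_0 + ... + s_(n-1) a_(n-1), with n = size s; the a_i with i >= n are
   ignored. *)
Definition lincomb M (s : seq M) (a : nat -> A) : M :=
  \sum_(i < size s) (a i : A^c) *: s`_i.

Definition generates M (s : seq M) : Prop :=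
  forall x, exists a, x = lincomb s a.

Definition fin_gen M : Prop := exists s : seq M, generates s.

Definition graded_projective P : Prop :=
  forall (M N : gradedModule A) (p : {linear M -> N}) (f : {linear P -> N}),
    graded_hom p -> graded_hom f -> (forall y, exists x, p x = y) ->
    exists2 h : {linear P -> M}, graded_hom h & forall x, p (h x) = f x.

Lemma graded_iso_refl M : graded_iso M M.
Proof. by exists idfun, idfun; split. Qed.

Lemma graded_iso_sym M N : graded_iso M N -> graded_iso N M.
Proof. by move=> [f [f' [? ? ? ?]]]; exists f', f; split. Qed.

Lemma graded_iso_trans N M P : graded_iso M N -> graded_iso N P -> graded_iso M P.
Proof.
move=> [f [f' [gf gf' fK fK']]] [k [k' [gk gk' kK kK']]].
exists (k \o f), (f' \o k'); split; try exact: can_comp.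
- by move=> g x hx; apply/gk/gf.
- by move=> g x hx; apply/gf'/gk'.
Qed.

Section Shift.
Variables (a : G) (M : gradedModule A).

Lemma shift_grading : is_grading (fun g => @gm_homog _ _ M (a + g)).
Proof.
have [sub dec ind] := gm_grading M; split=> [g|v|s f us hf S g gs].
- exact: sub.
- have [s hs ->] := dec v; exists s => // x /hs[g hg].
  by exists (g - a); rewrite addrC subrK.
have := ind [seq a + h | h <- s] (fun h => f (h - a)).
rewrite map_inj_uniq ?big_map; last exact: addrI.
move=> /(_ us) /=.
under eq_bigr => h _ do rewrite addrAC subrr add0r.
have hf' h : gm_homog h (f (h - a)) by rewrite -[h in gm_homog h](subrK a) addrC.
by move=> /(_ hf' S (a + g)); rewrite addrAC subrr add0r; apply; apply: map_f.
Qed.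

Definition gshift : gradedModule A.
Proof.
apply: (GradedModule shift_grading) => g h x b hx hb.
by rewrite addrA; apply: gm_homogM.
Defined.

End Shift.

Section DirectSum.
Variables M N : gradedModule A.

Definition dsum_homog (g : G) : set (M * N)%type :=
  [set u | gm_homog g u.1 /\ gm_homog g u.2].

Lemma dsum_grading : is_grading dsum_homog.
Proof.
have [subM decM indM] := gm_grading M; have [subN decN indN] := gm_grading N.
split=> [g|[x y]|s f us hf S g gs].
- split; first by split; [apply: (subM g).1|apply: (subN g).1].
  move=> u v [u1 u2] [v1 v2].
  by split; [apply: (subM g).2|apply: (subN g).2].
- have [s hs ->] := decM x; have [t ht ->] := decN y.
  exists ([seq (x, 0) | x <- s] ++ [seq (0, y) | y <- t]).
    move=> u; rewrite mem_cat => /orP[]/mapP[z zs ->].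
      have [g hg] := hs _ zs; exists g; split=> //; exact: (subN g).1.
    have [g hg] := ht _ zs; exists g; split=> //; exact: (subM g).1.
  rewrite big_cat !big_map /=.
  apply: injective_projections; rewrite /= !raddf_sum /=.
    by rewrite [X in _ = _ + X]big1 ?addr0.
  by rewrite [X in _ = X + _]big1 ?add0r.
have S1 : \sum_(g <- s) (f g).1 = 0 by rewrite -[RHS](congr1 fst S) raddf_sum.
have S2 : \sum_(g <- s) (f g).2 = 0 by rewrite -[RHS](congr1 snd S) raddf_sum.
apply: injective_projections => /=.
  by apply: (indM s (fun g => (f g).1)) => // h; have [] := hf h.
by apply: (indN s (fun g => (f g).2)) => // h; have [] := hf h.
Qed.

Definition gdsum : gradedModule A.
Proof.
apply: (@GradedModule _ _ (M * N)%type _ dsum_grading).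
by move=> g h [x y] b [/= hx hy] hb; split; apply: gm_homogM.
Defined.

End DirectSum.

Lemma zero_grading : is_grading (fun (_ : G) => @setT ('rV[A^c]_0)).
Proof.
split=> // [v|s f _ _ _ g _]; last exact: thinmx0.
by exists [::] => //; rewrite big_nil thinmx0.
Qed.

Definition gzero : gradedModule A.
Proof. by apply: (GradedModule zero_grading). Defined.

End GradedModules.

Section Closure.
Variables (G : zmodType) (A : gradedRing G).
Implicit Types M N P Q : gradedModule A.

Lemma lincomb_map M N (f : {linear M -> N}) s a :
  lincomb (map f s) a = f (lincomb s a).
Proof.
rewrite /lincomb size_map linear_sum; apply: eq_bigr => i _.
by rewrite linearZ (nth_map 0).
Qed.

Lemma lincomb_cat M (s t : seq M) a b :
  lincomb (s ++ t) (fun i => if (i < size s)%N then a i else b (i - size s)%N)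
  = lincomb s a + lincomb t b.
Proof.
rewrite /lincomb size_cat big_split_ord /=; congr (_ + _); apply: eq_bigr => i _.
  by rewrite nth_cat ltn_ord.
by rewrite nth_cat ltnNge leq_addr /= addKn.
Qed.

Lemma lincombB M (s : seq M) a b :
  lincomb s (fun i => a i - b i) = lincomb s a - lincomb s b.
Proof. by rewrite -sumrB; apply: eq_bigr => i _; rewrite -scalerBl. Qed.

Lemma lincombD M (s : seq M) a b :
  lincomb s (fun i => a i + b i) = lincomb s a + lincomb s b.
Proof. by rewrite -big_split; apply: eq_bigr => i _; rewrite /= -scalerDl. Qed.

Lemma lincombZ M (s : seq M) (c : A^c) a :
  lincomb s (fun i => c * (a i : A^c)) = c *: lincomb s a.
Proof. by rewrite scaler_sumr; apply: eq_bigr => i _; rewrite scalerA. Qed.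

Section Inj.
Variables M N : gradedModule A.

Definition dsum_inl (x : M) : gdsum M N := (x, 0).
Definition dsum_inr (y : N) : gdsum M N := (0, y).
Definition dsum_fst (u : gdsum M N) : M := u.1.
Definition dsum_snd (u : gdsum M N) : N := u.2.

Lemma dsum_inl_linear : linear dsum_inl.
Proof. by move=> a x y; congr (_, _); rewrite /= scaler0 addr0. Qed.
Lemma dsum_inr_linear : linear dsum_inr.
Proof. by move=> a x y; congr (_, _); rewrite /= scaler0 addr0. Qed.
Lemma dsum_fst_linear : linear dsum_fst. Proof. by []. Qed.
Lemma dsum_snd_linear : linear dsum_snd. Proof. by []. Qed.

HB.instance Definition _ :=
  GRing.isLinear.Build A^c M (gdsum M N) _ dsum_inl dsum_inl_linear.
HB.instance Definition _ :=
  GRing.isLinear.Build A^c N (gdsum M N) _ dsum_inr dsum_inr_linear.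
HB.instance Definition _ :=
  GRing.isLinear.Build A^c (gdsum M N) M _ dsum_fst dsum_fst_linear.
HB.instance Definition _ :=
  GRing.isLinear.Build A^c (gdsum M N) N _ dsum_snd dsum_snd_linear.

Lemma graded_inl : graded_hom dsum_inl.
Proof. by move=> g x hx; split=> //=; have [/(_ g)[]] := gm_grading N. Qed.
Lemma graded_inr : graded_hom dsum_inr.
Proof. by move=> g x hx; split=> //=; have [/(_ g)[]] := gm_grading M. Qed.

End Inj.

Lemma gm_homogD M g (x y : M) :
  gm_homog g x -> gm_homog g y -> gm_homog g (x + y).
Proof.
have [/(_ g)[h0 hB] _ _] := gm_grading M; move=> hx hy.
by rewrite -[y]opprK -[- y]sub0r; apply: (hB) => //; apply: hB.
Qed.

Lemma fin_gen_dsum M N : fin_gen M -> fin_gen N -> fin_gen (gdsum M N).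
Proof.
move=> [s hs] [t ht]; exists (map (@dsum_inl M N) s ++ map (@dsum_inr M N) t).
move=> u; have [a ea] := hs (dsum_fst u); have [b eb] := ht (dsum_snd u).
exists (fun i => if (i < size (map (@dsum_inl M N) s))%N then a i else
  b (i - size (map (@dsum_inl M N) s))%N).
rewrite lincomb_cat !lincomb_map -ea -eb.
by apply: injective_projections; rewrite /= ?addr0 ?add0r.
Qed.

Lemma projective_dsum M N :
  graded_projective M -> graded_projective N -> graded_projective (gdsum M N).
Proof.
move=> pM pN X Y p f gp gf surj.
have gl : @graded_hom _ _ M Y (f \o @dsum_inl M N) by move=> g x hx; apply/(gf g (dsum_inl N x))/graded_inl.
have gr : @graded_hom _ _ N Y (f \o @dsum_inr M N) by move=> g x hx; apply/(gf g (dsum_inr M x))/graded_inr.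
have [h gh hE] := pM _ _ p _ gp gl surj.
have [k gk kE] := pN _ _ p _ gp gr surj.
exists ((h \o @dsum_fst M N) \+ (k \o @dsum_snd M N)).
  by move=> g u [u1 u2]; apply: gm_homogD; [apply: gh|apply: gk].
move=> u; rewrite /= linearD hE kE /= -linearD; congr (f _).
by apply: injective_projections; rewrite /= ?addr0 ?add0r.
Qed.

Lemma fin_gen_shift a M : fin_gen M -> fin_gen (gshift a M).
Proof. by []. Qed.

Lemma projective_shift a M : graded_projective M -> graded_projective (gshift a M).
Proof.
move=> pM X Y p f gp gf surj.
have gp' : @graded_hom _ _ (gshift (- a) X) (gshift (- a) Y) p.
  by move=> g x; apply: gp.
have gf' : @graded_hom _ _ M (gshift (- a) Y) f.
  by move=> g x hx; apply: gf; rewrite /= addrA subrr add0r.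
have [h gh hE] := pM (gshift (- a) X) (gshift (- a) Y) p f gp' gf' surj.
exists h => // g x hx.
by have := gh _ _ hx; rewrite /= addKr.
Qed.

Lemma fin_gen_zero : fin_gen (gzero A).
Proof. by exists [::] => x; exists (fun=> 0); rewrite /lincomb big_ord0; apply: thinmx0. Qed.

Lemma projective_zero : graded_projective (gzero A).
Proof.
move=> X Y p f gp gf surj; exists \0.
  by move=> g x _; have [/(_ g)[]] := gm_grading X.
by move=> x; rewrite raddf0 (_ : x = 0) ?raddf0 //; apply: thinmx0.
Qed.

End Closure.

Record gradedProj (G : zmodType) (A : gradedRing G) := GradedProj {
  gp_mod :> gradedModule A;
  gp_fin_gen : fin_gen gp_mod;
  gp_projective : graded_projective gp_mod
}.

Section GradedProj.
Variables (G : zmodType) (A : gradedRing G).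

Definition gp_dsum (P Q : gradedProj A) : gradedProj A :=
  GradedProj (fin_gen_dsum (gp_fin_gen P) (gp_fin_gen Q))
             (projective_dsum (@gp_projective _ _ P) (@gp_projective _ _ Q)).

Definition gp_shift (a : G) (P : gradedProj A) : gradedProj A :=
  GradedProj (@fin_gen_shift _ _ a _ (gp_fin_gen P))
             (@projective_shift _ _ a _ (@gp_projective _ _ P)).

Definition gp_zero : gradedProj A :=
  GradedProj (@fin_gen_zero _ A) (@projective_zero _ A).

(* [gradedProj A] quantifies over all carrier types, so it is too large to
   carry library structures itself.  Its isomorphism classes form a small type:
   a class is encoded by the set of all presentations of its members, where a
   generating sequence s of P yields as presentation the set of relations
   between the elements of s, together with, for each g, the set of coefficient
   families whose linear combination lies in P_g.  The lemmas [isoclass_of_eq]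
   and [isoclass_of_surj] show that this is the quotient of [gradedProj A] by
   graded isomorphism. *)
Definition presentation : Type :=
  (set (nat -> A) * (G -> set (nat -> A)))%type.

Definition presentation_of (P : gradedProj A) (s : seq P) : presentation :=
  ([set a | lincomb s a = 0], fun g => [set a | gm_homog g (lincomb s a)]).

Definition presentations (P : gradedProj A) : set presentation :=
  [set presentation_of s | s in [set s : seq P | generates s]].

Definition isoclass : Type :=
  {C : set presentation | exists P : gradedProj A, C = presentations P}.

HB.instance Definition _ := gen_eqMixin isoclass.
HB.instance Definition _ := gen_choiceMixin isoclass.

Definition isoclass_of (P : gradedProj A) : isoclass :=
  exist _ (presentations P) (ex_intro _ P erefl).

Definition isoclass_repr (C : isoclass) : gradedProj A :=
  projT1 (cid (proj2_sig C)).

Lemma isoclass_reprK C : isoclass_of (isoclass_repr C) = C.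
Proof.
rewrite /isoclass_of /isoclass_repr; case: cid => P /= e.
by case: C e => C hC /= e; apply/eq_exist.
Qed.

Lemma isoclass_of_surj C : exists P, C = isoclass_of P.
Proof. by exists (isoclass_repr C); rewrite isoclass_reprK. Qed.

Lemma presentations_sub (P Q : gradedProj A) :
  graded_iso P Q -> presentations P `<=` presentations Q.
Proof.
move=> [f [f' [gf gf' fK fK']]] _ [s hs <-].
exists (map f s).
  by move=> y; have [a ea] := hs (f' y); exists a; rewrite lincomb_map -ea fK'.
rewrite /presentation_of; congr (_, _).
  apply/seteqP; split=> a /=; rewrite lincomb_map; last by move=> ->; rewrite raddf0.
  by move=> e; rewrite -[lincomb s a]fK e raddf0.
apply/funext => g; apply/seteqP; split=> a /=; rewrite lincomb_map.
  by move=> /gf'; rewrite fK.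
exact: gf.
Qed.

Section SamePresentation.
Variables (P Q : gradedProj A) (s : seq P) (t : seq Q).
Hypotheses (hs : generates s) (ht : generates t).
Hypothesis (st : presentation_of s = presentation_of t).

Definition pres_map (x : P) : Q := lincomb t (projT1 (cid (hs x))).

Lemma pres_mapE a : pres_map (lincomb s a) = lincomb t a.
Proof.
rewrite /pres_map; case: cid => b /= eb; apply/eqP; rewrite -subr_eq0 -lincombB.
have : (presentation_of s).1 (fun i => b i - a i).
  by rewrite /= lincombB -eb subrr.
by rewrite st /= => ->.
Qed.

Lemma pres_map_linear : linear pres_map.
Proof.
move=> c x y; have [a ->] := hs x; have [b ->] := hs y.
by rewrite -lincombZ -lincombD !pres_mapE lincombD lincombZ.
Qed.

Lemma pres_map_graded : graded_hom pres_map.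
Proof.
move=> g x; have [a ->] := hs x; rewrite pres_mapE => hx.
have : (presentation_of s).2 g a by [].
by rewrite st.
Qed.

HB.instance Definition _ :=
  GRing.isLinear.Build A^c P Q _ pres_map pres_map_linear.

Definition pres_linear : {linear P -> Q} := pres_map.

End SamePresentation.

Lemma isoclass_of_eq (P Q : gradedProj A) :
  isoclass_of P = isoclass_of Q <-> graded_iso P Q.
Proof.
split=> [/(congr1 (@proj1_sig _ _)) /= e|PQ]; last first.
  apply/eq_exist/seteqP; split; apply: presentations_sub => //.
  exact: graded_iso_sym.
have [s hs] := gp_fin_gen P.
have : presentations P (presentation_of s) by exists s.
rewrite e => -[t ht ts].
exists (pres_linear hs (esym ts)), (pres_linear ht ts).
split; try exact: pres_map_graded.
  by move=> x; have [a ->] := hs x; rewrite /= !pres_mapE.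
by move=> x; have [a ->] := ht x; rewrite /= !pres_mapE.
Qed.

Lemma graded_isoP (M N : gradedModule A) (f : M -> N) (f' : N -> M) :
  linear f -> linear f' -> graded_hom f -> graded_hom f' ->
  cancel f f' -> cancel f' f -> graded_iso M N.
Proof.
move=> lf lf' gf gf' fK fK'.
pose bf := GRing.isLinear.Build A^c M N _ f lf.
pose bf' := GRing.isLinear.Build A^c N M _ f' lf'.
pose F : {linear M -> N} := HB.pack f bf.
pose F' : {linear N -> M} := HB.pack f' bf'.
by exists F, F'; split.
Qed.

Lemma graded_iso_dsum (M M' N N' : gradedModule A) :
  graded_iso M M' -> graded_iso N N' -> graded_iso (gdsum M N) (gdsum M' N').
Proof.
move=> [f [f' [gf gf' fK fK']]] [k [k' [gk gk' kK kK']]].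
apply: (@graded_isoP (gdsum M N) (gdsum M' N')
  (fun u => (f u.1, k u.2)) (fun u => (f' u.1, k' u.2))).
- by move=> a u v; apply: injective_projections; rewrite /= linearP.
- by move=> a u v; apply: injective_projections; rewrite /= linearP.
- by move=> g u [u1 u2]; split; [apply: gf|apply: gk].
- by move=> g u [u1 u2]; split; [apply: gf'|apply: gk'].
- by move=> u; rewrite /= fK kK; case: u.
- by move=> u; rewrite /= fK' kK'; case: u.
Qed.

Lemma graded_iso_shift a (M N : gradedModule A) :
  graded_iso M N -> graded_iso (gshift a M) (gshift a N).
Proof.
move=> [f [f' [gf gf' fK fK']]]; exists f, f'.
by split=> // g x; [apply: gf|apply: gf'].
Qed.

Lemma gdsumC (M N : gradedModule A) : graded_iso (gdsum M N) (gdsum N M).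
Proof.
apply: (@graded_isoP (gdsum M N) (gdsum N M)
  (fun u => (u.2, u.1)) (fun u => (u.2, u.1))) => //.
- by move=> g u [].
- by move=> g u [].
- by case.
- by case.
Qed.

Lemma gdsumA (M N P : gradedModule A) :
  graded_iso (gdsum M (gdsum N P)) (gdsum (gdsum M N) P).
Proof.
apply: (@graded_isoP (gdsum M (gdsum N P)) (gdsum (gdsum M N) P)
  (fun u => ((u.1, u.2.1), u.2.2)) (fun u => (u.1.1, (u.1.2, u.2)))) => //.
- by move=> g u [? []].
- by move=> g u [[]].
- by case=> ? [].
- by case=> [[]].
Qed.

Lemma gdsum0 (M : gradedModule A) : graded_iso (gdsum (gzero A) M) M.
Proof.
apply: (@graded_isoP (gdsum (gzero A) M) M snd (fun x => (0, x))) => //.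
- by move=> a x y; apply: injective_projections => //=; rewrite scaler0 addr0.
- by move=> g u [].
- by case=> x y; congr (_, _); apply: esym; apply: thinmx0.
Qed.

Lemma gshift0 (M : gradedModule A) : graded_iso (gshift 0 M) M.
Proof.
apply: (@graded_isoP (gshift 0 M) M id id) => // g x; by rewrite /= add0r.
Qed.

Lemma gshiftA g h (M : gradedModule A) :
  graded_iso (gshift (g + h) M) (gshift g (gshift h M)).
Proof.
by apply: (@graded_isoP (gshift (g + h) M) (gshift g (gshift h M)) id id) => // k x;
  rewrite /= addrA (addrC h).
Qed.

Lemma gshiftD g (M N : gradedModule A) :
  graded_iso (gshift g (gdsum M N)) (gdsum (gshift g M) (gshift g N)).
Proof.
exact: (@graded_isoP (gshift g (gdsum M N)) (gdsum (gshift g M) (gshift g N)) id id).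
Qed.

Definition isoclass_add (C D : isoclass) : isoclass :=
  isoclass_of (gp_dsum (isoclass_repr C) (isoclass_repr D)).

Definition isoclass_shift (g : G) (C : isoclass) : isoclass :=
  isoclass_of (gp_shift g (isoclass_repr C)).

Lemma isoclass_repr_iso P : graded_iso (isoclass_repr (isoclass_of P)) P.
Proof. by apply/isoclass_of_eq; rewrite isoclass_reprK. Qed.

Lemma isoclass_addE P Q :
  isoclass_add (isoclass_of P) (isoclass_of Q) = isoclass_of (gp_dsum P Q).
Proof. by apply/isoclass_of_eq/graded_iso_dsum; apply: isoclass_repr_iso. Qed.

Lemma isoclass_shiftE g P :
  isoclass_shift g (isoclass_of P) = isoclass_of (gp_shift g P).
Proof. by apply/isoclass_of_eq/graded_iso_shift/isoclass_repr_iso. Qed.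

Lemma isoclass_addA : associative isoclass_add.
Proof.
move=> C D E; have [P ->] := isoclass_of_surj C; have [Q ->] := isoclass_of_surj D.
have [R ->] := isoclass_of_surj E; rewrite !isoclass_addE.
by apply/isoclass_of_eq/gdsumA.
Qed.

Lemma isoclass_addC : commutative isoclass_add.
Proof.
move=> C D; have [P ->] := isoclass_of_surj C; have [Q ->] := isoclass_of_surj D.
by rewrite !isoclass_addE; apply/isoclass_of_eq/gdsumC.
Qed.

Lemma isoclass_add0 : left_id (isoclass_of gp_zero) isoclass_add.
Proof.
move=> C; have [P ->] := isoclass_of_surj C.
by rewrite isoclass_addE; apply/isoclass_of_eq/gdsum0.
Qed.

HB.instance Definition _ := GRing.isNmodule.Build isoclass
  isoclass_addA isoclass_addC isoclass_add0.

Lemma isoclass_shiftD g : {morph isoclass_shift g : C D / C + D}.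
Proof.
move=> C D; have [P ->] := isoclass_of_surj C; have [Q ->] := isoclass_of_surj D.
rewrite [_ + _ in LHS]isoclass_addE !isoclass_shiftE [RHS]isoclass_addE.
by apply/isoclass_of_eq/gshiftD.
Qed.

Lemma isoclass_shift0 : isoclass_shift 0 =1 id.
Proof.
move=> C; have [P ->] := isoclass_of_surj C.
by rewrite isoclass_shiftE; apply/isoclass_of_eq/gshift0.
Qed.

Lemma isoclass_shiftA g h C :
  isoclass_shift (g + h) C = isoclass_shift g (isoclass_shift h C).
Proof.
have [P ->] := isoclass_of_surj C.
by rewrite !isoclass_shiftE; apply/isoclass_of_eq/gshiftA.
Qed.

Definition K0gr : Type := gcompl isoclass.
HB.instance Definition _ := GRing.Zmodule.on K0gr.

Definition K0gr_class (P : gradedProj A) : K0gr := gclass (isoclass_of P).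

Definition K0gr_shift (g : G) : K0gr -> K0gr := gcompl_map (isoclass_shift g).

Lemma K0gr_shiftD g : {morph K0gr_shift g : u v / u + v}.
Proof.
move=> u v; have [a [b ->]] := gsub_surj u; have [c [d ->]] := gsub_surj v.
rewrite [_ + _ in LHS]gsubD /K0gr_shift !gcompl_mapE; try exact: isoclass_shiftD.
by rewrite [RHS]gsubD !isoclass_shiftD.
Qed.

Lemma K0gr_shift0 : K0gr_shift 0 =1 id.
Proof.
move=> u; have [a [b ->]] := gsub_surj u.
by rewrite /K0gr_shift gcompl_mapE ?isoclass_shift0 //; apply: isoclass_shiftD.
Qed.

Lemma K0gr_shiftA g h u : K0gr_shift (g + h) u = K0gr_shift g (K0gr_shift h u).
Proof.
have [a [b ->]] := gsub_surj u; rewrite /K0gr_shift.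
rewrite (gcompl_mapE a b (isoclass_shiftD h)).
by rewrite !gcompl_mapE ?isoclass_shiftA //; apply: isoclass_shiftD.
Qed.

HB.instance Definition _ := GRing.Zmodule_isLmodule.Build (zgr G) K0gr
  (zgr_scaleA K0gr_shiftD K0gr_shiftA) (zgr_scale1 K0gr_shift0)
  (zgr_scaleDr K0gr_shiftD) (zgr_scaleDl K0gr_shift).

Lemma K0gr_classD P Q : K0gr_class (gp_dsum P Q) = K0gr_class P + K0gr_class Q.
Proof.
by rewrite [RHS]gsubD addr0 /K0gr_class -isoclass_addE.
Qed.

Lemma K0gr_classZ g P :
  (<< g >> : zgr G) *: K0gr_class P = K0gr_class (gp_shift g P).
Proof.
rewrite [LHS]zgr_scaleU /K0gr_shift /K0gr_class /gclass.
rewrite gcompl_mapE; last exact: isoclass_shiftD.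
rewrite isoclass_shiftE; congr (gsub _ _).
rewrite [LHS]isoclass_shiftE; apply/isoclass_of_eq.
exact: (@graded_isoP (gshift g (gzero A)) (gzero A) id id).
Qed.

End GradedProj.

(* Main.v *)
Require Import Defs.
From HB Require Import structures.
From mathcomp Require Import all_boot all_algebra.
From mathcomp Require Import boolp classical_sets.
From mathcomp Require Import freeg.

Set Implicit Arguments.
Unset Strict Implicit.
Unset Printing Implicit Defensive.

Import GRing.Theory.
Local Open Scope ring_scope.
Local Open Scope quotient_scope.

(** The theorem is a Krull-Schmidt statement.  Write A(d) for the shifted
    regular module and J for the two-sided ideal generated by the noninvertible
    homogeneous elements.  A homogeneous element outside J is invertible by
    construction of J, and an invertible element is outside J because J is
    proper; so whether a homogeneous element is invertible can be tested modulo
    J, where sums and products behave well.  Three facts follow.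

    - Every graded finitely generated projective P is isomorphic to some
      A(d_1) + ... + A(d_n) ([projective_free]).  Take a graded surjection p
      from such a sum F onto P with n minimal.  A homogeneous element of ker p
      with a coordinate outside J, hence invertible, would express one generator
      through the others ([cover_shrink]); so the homogeneous elements of ker p
      lie in F J.  If s is a section of p, the idempotent 1 - s p has its image
      in F J, and Nakayama's lemma ([free_nakayama]) makes it zero.

    - The classes of the d_i modulo Gamma_A^* are determined up to order by P
      ([free_iso_perm]).  An isomorphism of two such sums sends the first
      generator, of degree -d_1 say, to a homogeneous element outside F J, since
      the inverse isomorphism brings it back to a generator.  So some coordinate
      of that element is invertible, its degree shows that d_1 is congruent to
      the corresponding shift, and a Gaussian elimination step
      ([corner_cancel]) removes both summands.

    - A(a) and A(b) are isomorphic if b - a is in Gamma_A^* ([line_iso]): left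
      multiplication by a homogeneous unit is a right module map.

    Thus the monoid of isomorphism classes is the free commutative monoid on
    Gamma / Gamma_A^*, with Gamma acting by translation.  The isomorphism
    is the group completion of the map [rank], sending the class of
    A(d_1) + ... + A(d_n) to the sum of the basis elements indexed by the
    classes of the d_i. *)

(** * Homogeneous components *)

Section Gradings.
Variables (G V : zmodType) (V_ : G -> set V).
Hypothesis gV : is_grading V_.

Lemma grading0 g : V_ g 0.
Proof. by have [/(_ g)[]] := gV. Qed.

Lemma gradingB g x y : V_ g x -> V_ g y -> V_ g (x - y).
Proof. by have [/(_ g)[_ +] _ _] := gV; apply. Qed.

Lemma gradingN g x : V_ g x -> V_ g (- x).
Proof. by rewrite -sub0r; apply/gradingB/grading0. Qed.

Lemma gradingD g x y : V_ g x -> V_ g y -> V_ g (x + y).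
Proof. by move=> hx hy; rewrite -[y]opprK; apply/gradingB/gradingN. Qed.

Lemma grading_decomp v : exists (s : seq G) (f : G -> V),
  [/\ uniq s, forall g, V_ g (f g) & v = \sum_(g <- s) f g].
Proof.
have [_ /(_ v)[r hr ev] _] := gV; rewrite {}ev.
elim: r hr => [|x r IHr] hr.
  exists [::], (fun=> 0); split; rewrite ?big_nil // => g; exact: grading0.
rewrite big_cons; have /IHr[s [f [us hf ->]]] : forall y, y \in r -> exists g, V_ g y.
  by move=> y yr; apply: hr; rewrite inE yr orbT.
have [g hg] : exists g, V_ g x by apply: hr; rewrite inE eqxx.
have hf' h : V_ h (f h + (if h == g then x else 0)).
  by apply: gradingD => //; case: eqP => [->//|_]; apply: grading0.
have [gs|gs] := boolP (g \in s).
  exists s, (fun h => f h + (if h == g then x else 0)); split=> //.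
  rewrite big_split addrC /=; congr (_ + _).
  by rewrite (bigD1_seq g) //= eqxx big1 ?addr0 // => h /negPf->.
exists (g :: s), (fun h => if h == g then x else f h); split.
- by rewrite /= gs.
- by move=> h; case: eqP => [->|].
rewrite big_cons eqxx; congr (_ + _); apply: eq_big_seq => h hs.
by case: eqP => // hg'; rewrite -hg' hs in gs.
Qed.

End Gradings.

(** * The modules A(d) and their finite sums *)

Section Modules.
Variables (G : zmodType) (A : gradedRing G).
Implicit Types M N : gradedModule A.

Definition pack_linear (R : pzRingType) (U V : lmodType R) (f : U -> V)
    (lf : linear f) : {linear U -> V} :=
  HB.pack f (GRing.isLinear.Build R U V _ f lf).

(** The component [x'] of degree [g] of [x] has the same image as [x], because the
    components of [p x] outside degree [g] vanish.  Hence a surjective graded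
    map is surjective in each degree. *)
Lemma homog_preimage M N (p : {linear M -> N}) g x :
  graded_hom p -> gm_homog g (p x) ->
  exists2 x', gm_homog g x' & p x' = p x.
Proof.
move=> gp hx; have [s [f [us hf ex]]] := grading_decomp (gm_grading M) x.
pose t := undup (g :: s).
(* the components of [p x] read off from those of [x], minus [p x] in degree
   [g]: they sum to zero, hence all vanish *)
pose F h := (if h \in s then p (f h) else 0) - (if h == g then p x else 0).
have hF h : gm_homog h (F h).
  apply: (gradingB (gm_grading N)); case: ifP => [h1|_];
    rewrite ?(eqP h1) //; try exact/(grading0 (gm_grading N)); exact/gp.
have S : \sum_(h <- t) F h = 0.
  have st : {subset s <= t} by move=> h; rewrite mem_undup inE => ->; rewrite orbT.
  rewrite sumrB (sum_supp us (undup_uniq _) st); last by move=> i /negPf->.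
  rewrite (@sum_supp _ _ [:: g] t _ isT (undup_uniq _)).
  - rewrite big_seq1 eqxx (_ : \sum_(i <- s) _ = p x) ?subrr //.
    by rewrite [in RHS]ex linear_sum; apply: eq_big_seq => i ->.
  - by move=> h; rewrite mem_undup !inE => ->.
  - by move=> h; rewrite inE => /negPf->.
have [_ _ /(_ t F (undup_uniq _) hF S g)] := gm_grading N.
rewrite mem_undup mem_head => /(_ isT); rewrite /F eqxx => /subr0_eq.
case: ifP => [_ <-|_ <-]; first by exists (f g).
by exists 0; rewrite ?raddf0 //; apply/(grading0 (gm_grading M)).
Qed.

Definition greg : gradedModule A.
Proof.
by apply: (@GradedModule G A (A^c)^o (@homog G A) (homog_grading A)) =>
  g h x a; apply: homogM.
Defined.

Lemma greg_fin_gen : fin_gen greg.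
Proof.
exists [:: (1 : A)] => x; exists (fun=> x).
by rewrite /lincomb big_ord1 /= [RHS]mul1r.
Qed.

(** A graded map out of A is determined by the image of 1, which can be lifted
    within degree 0. *)
Lemma greg_projective : graded_projective greg.
Proof.
move=> M N p f gp gf surj.
have [x px] := surj (f (1 : A)).
have [|x' hx' px'] := @homog_preimage M N p 0 x gp.
  by rewrite px; apply/gf/homog1.
have lh : linear (fun a : greg => (a : A^c) *: x').
  by move=> c a b; rewrite scalerDl scalerA.
exists (pack_linear lh) => [g a ha|a] /=.
  by rewrite -[g]add0r; apply: gm_homogM.
rewrite linearZ /= px' px -linearZ; congr (f _).
exact: (mul1r (a : A)).
Qed.

Definition gp_reg : gradedProj A := GradedProj greg_fin_gen greg_projective.

(** The module A(d). *)
Definition gp_line (d : G) : gradedProj A := gp_shift d gp_reg.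

Fixpoint gp_free (l : seq G) : gradedProj A :=
  if l is d :: l' then gp_dsum (gp_line d) (gp_free l') else gp_zero A.

End Modules.

(** * Invertible homogeneous elements *)

Section LocalRing.
Variables (G : zmodType) (A : gradedRing G).

(** The ideal J.  By [homog_invertible] and [invertible_notin_radical], over a
    graded local ring its homogeneous elements are exactly the noninvertible
    ones. *)
Definition graded_radical : set A :=
  smallest (@two_sided_ideal A)
    [set a | (exists g, homog g a) /\ ~ invertible a].

Lemma graded_radical_ideal : two_sided_ideal graded_radical.
Proof.
split=> [I [[]]|x y hx hy I IP|a x hx] //.
  by have [[_ + _] _] := IP; apply; [apply: hx|apply: hy].
by split=> I IP; have [[_ _ /(_ a x (hx I IP))[]]] := IP.
Qed.

Lemma graded_radicalD x y :
  graded_radical x -> graded_radical y -> graded_radical (x + y).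
Proof.
have [r0 rB _] := graded_radical_ideal => hx hy.
by rewrite -[y]opprK -[- y]sub0r; apply: (rB) => //; apply: rB.
Qed.

Lemma graded_radicalMl a x : graded_radical x -> graded_radical (a * x).
Proof. by have [_ _ rM] := graded_radical_ideal => /(rM a)[]. Qed.

Lemma graded_radicalMr x a : graded_radical x -> graded_radical (x * a).
Proof. by have [_ _ rM] := graded_radical_ideal => /(rM a)[]. Qed.

Lemma homog_invertible g a : homog g a -> ~ graded_radical a -> invertible a.
Proof.
move=> ha; apply: contra_notP => na I [_]; apply; split=> //.
by exists g.
Qed.

(** The component of degree [-g] of an inverse of [a] is already a right inverse
    of [a], so by uniqueness it is the whole inverse. *)
Lemma homog_inverse g (a b : A) :
  homog g a -> a * b = 1 -> b * a = 1 -> homog (- g) b.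
Proof.
move=> ha ab ba; have [s [f [us hf f0 Eb]]] := homog_decomp b.
have E1 : a * f (- g) = 1.
  by rewrite -[- g]sub0r; apply: (homog_divl ha (homog1 A) us hf f0 Eb).
by rewrite (_ : b = f (- g)) // -[b]mulr1 -E1 mulrA ba mul1r.
Qed.

Hypothesis locA : graded_local A.

Lemma invertible_notin_radical a : invertible a -> ~ graded_radical a.
Proof.
move=> [b [ab ba]] ra; apply: locA; apply/seteqP; split=> // x _.
rewrite -[x]mulr1 -ab; apply: graded_radicalMl; exact: graded_radicalMr.
Qed.

Lemma one_notin_radical : ~ graded_radical 1.
Proof. by apply: invertible_notin_radical; exists 1; rewrite mulr1. Qed.

Lemma invertible_1B c :
  homog 0 c -> graded_radical c -> invertible (1 - c).
Proof.
move=> hc rc; apply: (@homog_invertible 0).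
  by apply: homogB => //; apply: homog1.
by move=> r1; apply: one_notin_radical; rewrite -[1](subrK c); apply: graded_radicalD.
Qed.

End LocalRing.

(** * Cancelling a summand A(d) *)

Section Cancellation.
Variables (G : zmodType) (A : gradedRing G).
Implicit Types (M N P Q : gradedModule A).

(** Gaussian elimination with the invertible corner N -> M of a two by two block
    isomorphism.  In one direction P is mapped to Q by the Schur complement: [x]
    is completed to the only element [(a, x)] whose image has zero first
    component, and the second component is kept.  In the other direction no
    correction is needed, the corresponding block of [f'] is the inverse. *)
Lemma corner_cancel M N P Q (f : {linear gdsum M P -> gdsum N Q})
    (f' : {linear gdsum N Q -> gdsum M P}) (k : {linear N -> M}) :
  graded_hom f -> graded_hom f' -> cancel f f' -> cancel f' f ->
  graded_hom k -> (forall a, k (f (a, 0)).1 = a) ->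
  (forall b, (f (k b, 0)).1 = b) -> graded_iso P Q.
Proof.
move=> gf gf' fK fK' gk kf fk.
pose lift x : gdsum M P := (- k (f (0, x)).1, x).
have fstf a x : (f (a, x)).1 = (f (a, 0)).1 + (f (0, x)).1.
  rewrite -[RHS]/(f (a, 0) + f (0, x)).1 -raddfD.
  by congr (f _).1; apply: injective_projections; rewrite /= ?addr0 ?add0r.
have flift x : (f (lift x)).1 = 0.
  rewrite fstf -[- k _]raddfN fk.
  exact: addNr.
apply: (@graded_isoP _ _ P Q (fun x => (f (lift x)).2) (fun y => (f' (0, y)).2)).
- move=> c x y; rewrite -[RHS]/(c *: f (lift x) + f (lift y)).2 -linearP.
  congr (f _).2; apply: injective_projections => //=.
  rewrite -[in LHS](_ : c *: (0, x) + (0, y) = (0, c *: x + y) :> gdsum M P).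
    by rewrite linearP /= linearP /= opprD scalerN.
  by apply: injective_projections; rewrite /= ?scaler0 ?addr0.
- move=> c x y; rewrite -[RHS]/(c *: f' (0, x) + f' (0, y)).2 -linearP.
  congr (f' _).2; apply: injective_projections => //=.
  by rewrite scaler0 addr0.
- move=> g x hx; apply: (gf _ _ _).2; split=> //=.
  apply/(gradingN (gm_grading M))/gk/(gf _ _ _).1; split=> //=.
  exact: (grading0 (gm_grading M)).
- move=> g x hx; apply: (gf' _ _ _).2; split=> //=.
  exact: (grading0 (gm_grading N)).
- move=> x; rewrite (_ : (0, _) = f (lift x)) ?fK //.
  by apply: injective_projections; rewrite /= ?flift.
- move=> y; set u := f' _.
  suff -> : lift u.2 = u by rewrite fK'.
  apply: injective_projections => //=.
  have e : (f (0, u.2)).1 = - (f (u.1, 0)).1.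
    apply/eqP; rewrite -addr_eq0 addrC -fstf -surjective_pairing.
    by rewrite /u fK'.
  by rewrite e raddfN opprK; apply: kf.
Qed.

(** Left multiplication by a unit of degree [b - a] maps the part A_(a + g) of
    degree g of A(a) onto the part A_(b + g) of A(b), and commutes with the right
    action. *)
Lemma line_iso a b :
  b - a \in unit_support A -> graded_iso (gp_line A a) (gp_line A b).
Proof.
move=> /asboolP[u hu [u' [uu' u'u]]].
have hu' : homog (a - b) u' by rewrite -opprB; apply: (homog_inverse hu).
apply: (@graded_isoP _ _ (gp_line A a) (gp_line A b)
  (fun x : A => u * x) (fun x : A => u' * x)).
- by move=> c x y; rewrite mulrDr; congr (_ + _); exact: (@mulrA A u x c).
- by move=> c x y; rewrite mulrDr; congr (_ + _); exact: (@mulrA A u' x c).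
- by move=> g x hx; rewrite /= -[b](subrK a) -addrA; apply: homogM.
- by move=> g x hx; rewrite /= -[a](subrK b) -addrA; apply: homogM.
- by move=> x; rewrite mulrA u'u mul1r.
- by move=> x; rewrite mulrA uu' mul1r.
Qed.

Definition line_gen d : gp_line A d := (1 : A).

Lemma line_genE d (a : A) : (a : gp_line A d) = (a : A^c) *: line_gen d.
Proof. by rewrite -[LHS]mul1r. Qed.

Lemma homog_line_gen d : gm_homog (- d) (line_gen d).
Proof. by rewrite /= subrr; apply: homog1. Qed.

(** The corner A(a) -> A(b) is left multiplication by the image [c] of the
    generator, and [c] has degree [b - a]. *)
Lemma line_cancel a b P Q (f : {linear gdsum (gp_line A a) P -> gdsum (gp_line A b) Q})
    (f' : {linear gdsum (gp_line A b) Q -> gdsum (gp_line A a) P}) :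
  graded_hom f -> graded_hom f' -> cancel f f' -> cancel f' f ->
  invertible ((f (line_gen a, 0)).1 : A) ->
  b - a \in unit_support A /\ graded_iso P Q.
Proof.
move=> gf gf' fK fK'; set c : A := (f _).1 => -[c' [cc' c'c]].
have hc : homog (b - a) c.
  apply: (gf (- a) (line_gen a, 0) _).1; split; first exact: homog_line_gen.
  exact: (grading0 (gm_grading P)).
have hc' : homog (a - b) c' by rewrite -opprB; apply: (homog_inverse hc).
split; first by apply/asboolP; exists c => //; exists c'.
have fE x : (f (x, 0)).1 = c * x.
  rewrite [X in f X](_ : _ = (x : A^c) *: (line_gen a, 0)) ?linearZ //.
  apply: (@injective_projections (gp_line A a) P); rewrite /= ?scaler0 //.
  exact: line_genE.
have lk : linear (fun x : gp_line A b => c' * (x : A) : gp_line A a).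
  by move=> r x y; rewrite mulrDr; congr (_ + _); exact: (@mulrA A c' x r).
apply: (@corner_cancel _ _ _ _ f f' (pack_linear lk)) => //=.
- move=> g x hx; have := homogM hc' (hx : homog (b + g) (x : A)).
  by rewrite addrA subrK.
- by move=> x; rewrite fE mulrA c'c mul1r.
- by move=> x; rewrite fE mulrA cc' mul1r.
Qed.

End Cancellation.

(** * Uniqueness of the decomposition *)

Section FreeModules.
Variables (G : zmodType) (A : gradedRing G).
Implicit Types (N : gradedModule A) (l m : seq G).

Local Notation free := (gp_free A).
Local Notation rad := (graded_radical (A := A)).

(** The submodule F J of F = [free l]: the vectors with all coordinates in J. *)
Fixpoint in_radical l : free l -> Prop :=
  match l return free l -> Prop with
  | [::] => fun=> True
  | d :: l' => fun v => rad v.1 /\ in_radical v.2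
  end.

Lemma graded_radical0 : rad 0.
Proof. by have [] := graded_radical_ideal A. Qed.

Lemma in_radical0 l : in_radical (0 : free l).
Proof. by elim: l => //= d l IHl; split=> //; apply: graded_radical0. Qed.

Lemma in_radicalD l (v w : free l) :
  in_radical v -> in_radical w -> in_radical (v + w).
Proof.
elim: l v w => //= d l IHl v w [v1 v2] [w1 w2]; split; last exact: IHl.
exact: graded_radicalD.
Qed.

Lemma in_radicalZ l (v : free l) (a : A^c) : in_radical v -> in_radical (a *: v).
Proof.
elim: l v => //= d l IHl v [v1 v2]; split; last exact: IHl.
exact: graded_radicalMr.
Qed.

Definition free_gen d l : free (d :: l) := (line_gen A d, 0).

Lemma homog_free_gen d l : gm_homog (- d) (free_gen d l).
Proof.
split; first exact: homog_line_gen.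
exact: (grading0 (gm_grading (free l))).
Qed.

Lemma free_consE d l (v : free (d :: l)) :
  v = (v.1 : A^c) *: free_gen d l + ((0, v.2) : free (d :: l)).
Proof.
apply: (@injective_projections (gp_line A d) (free l)) => /=.
  by rewrite addr0; apply: line_genE.
by rewrite scaler0 add0r.
Qed.

Lemma free_linearE d l N (f : {linear free (d :: l) -> N}) v :
  f v = (v.1 : A^c) *: f (free_gen d l) + f (0, v.2).
Proof. by rewrite {1}(free_consE v) linearP. Qed.

(** Restriction to the last summands; with [free_linearE] it is the tool for
    inductions on the number of summands. *)
Definition free_inr d l N (f : {linear free (d :: l) -> N}) : {linear free l -> N} :=
  f \o @dsum_inr _ _ (gp_line A d) (free l).

(** [f v] is a sum of terms c * v_i, and J is a left ideal. *)
Lemma in_radical_form d l (f : {linear free l -> gp_line A d}) v :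
  in_radical v -> rad (f v).
Proof.
elim: l f v => [|b l IHl] f v.
  by rewrite (thinmx0 v) raddf0 => _; apply: graded_radical0.
move=> [v1 v2]; rewrite free_linearE; apply: graded_radicalD.
  exact: graded_radicalMl.
exact: (IHl (free_inr f)).
Qed.

(** A homogeneous vector outside F J has a coordinate outside J, which is then
    invertible; the permutation [k] of the summands brings it to the front. *)
Lemma free_exchange l g (v : free l) :
  gm_homog g v -> ~ in_radical v ->
  exists b l', perm_eq l (b :: l') /\
  exists (k : {linear free l -> free (b :: l')})
         (k' : {linear free (b :: l') -> free l}),
  [/\ graded_hom k, graded_hom k', cancel k k', cancel k' k
    & invertible ((k v).1 : A)].
Proof.
elim: l v => [|d l IHl] v; first by move=> _ [].
move=> [h1 h2] nv; have [r1|r1] := pselect (rad v.1); last first.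
  exists d, l; split=> //; exists idfun, idfun; split=> //.
  exact: (homog_invertible h1).
have [|b [l' [pl [k [k' [gk gk' kK kK' ki]]]]]] := IHl v.2 h2.
  by move=> r2; apply: nv.
exists b, (d :: l'); split.
  by rewrite perm_sym (perm_catCA [:: b] [:: d]) /= perm_cons perm_sym.
have lK : linear (fun u : free (d :: l) =>
    ((k u.2).1, (u.1, (k u.2).2)) : free (b :: d :: l')).
  by move=> c x y; rewrite /= linearP.
have lK' : linear (fun u : free (b :: d :: l') =>
    (u.2.1, k' (u.1, u.2.2)) : free (d :: l)).
  move=> c x y; congr (_, _).
  exact: (linearP k' c (x.1, x.2.2) (y.1, y.2.2)).
exists (pack_linear lK), (pack_linear lK'); split=> //=.
- by move=> h u [u1 u2]; have [] := gk h u.2 u2.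
- by move=> h u [u1 [u2 u3]]; split=> //=; apply: gk'.
- by case=> u1 u2; rewrite /= -surjective_pairing kK.
- by case=> u1 [u2 u3]; rewrite /= kK'.
Qed.

Hypothesis locA : graded_local A.

Lemma free_eq0 l : graded_iso (free l) (free [::]) -> l = [::].
Proof.
case: l => // d l [f [f' [_ _ fK _]]].
case: (one_notin_radical locA).
have e0 : free_gen d l = 0.
  by rewrite -[LHS]fK (thinmx0 (f _)) raddf0.
rewrite -[1]/((free_gen d l).1 : A) e0; exact: graded_radical0.
Qed.

Local Notation class := (\pi_(Quotient.quot (unit_support A))).

Lemma eq_class a b : class a = class b <-> b - a \in unit_support A.
Proof. by rewrite Quotient.idealrBE; split=> [->//|/eqP->]. Qed.

(** Uniqueness of the decomposition, removing one summand of each side at a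
    time. *)
Theorem free_iso_perm l m :
  graded_iso (free l) (free m) -> perm_eq (map class l) (map class m).
Proof.
elim: l m => [|a l IHl] m; first by move=> /graded_iso_sym/free_eq0->.
move=> [f [f' [gf gf' fK fK']]]; set v := f (free_gen a l).
have hv : gm_homog (- a) v by apply/gf/homog_free_gen.
(* the first component of [f' v] is 1 *)
have nv : ~ in_radical v.
  pose f1 : {linear free m -> gp_line A a} :=
    @dsum_fst _ _ (gp_line A a) (free l) \o f'.
  move=> /(@in_radical_form a m f1); rewrite /f1 /= /v fK.
  exact: one_notin_radical.
have [b [m' [pm [k [k' [gk gk' kK kK' ki]]]]]] := free_exchange hv nv.
have gF : @graded_hom _ _ (free (a :: l)) (free (b :: m')) (k \o f).
  by move=> g x hx; apply/gk/gf.
have gF' : @graded_hom _ _ (free (b :: m')) (free (a :: l)) (f' \o k').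
  by move=> g x hx; apply/gf'/gk'.
have [ab lm] := line_cancel gF gF' (can_comp kK fK) (can_comp fK' kK') ki.
have /perm_trans-> // : perm_eq (map class (a :: l)) (map class (b :: m')).
  by rewrite /= ((eq_class a b).2 ab) perm_cons; apply: IHl.
by rewrite perm_sym; apply: perm_map.
Qed.

End FreeModules.

(** * Projective modules are sums of the A(d) *)

Section Existence.
Variables (G : zmodType) (A : gradedRing G).
Implicit Types (N : gradedModule A) (l : seq G).

Local Notation free := (gp_free A).

(** A homogeneous [x] of degree [g] is the image of the generator of A(-g). *)
Lemma homog_seq_cover N (r : seq N) :
  (forall x, x \in r -> exists g, gm_homog g x) ->
  exists l (p : {linear free l -> N}),
    graded_hom p /\ forall x, x \in r -> exists v, p v = x.
Proof.
elim: r => [|x r IHr] hr.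
  have l0 : linear (fun _ : free [::] => 0 : N).
    by move=> c u v; rewrite scaler0 addr0.
  exists [::], (pack_linear l0); split=> // g u _.
  exact: (grading0 (gm_grading N)).
have [|l [p [gp sp]]] := IHr; first by move=> y yr; apply: hr; rewrite inE yr orbT.
have [g hg] : exists g, gm_homog g x by apply: hr; rewrite mem_head.
have lq : linear (fun u : free (- g :: l) => (u.1 : A^c) *: x + p u.2).
  move=> c u v; rewrite scalerDr scalerA addrACA; congr (_ + _).
    exact: (scalerDl x (c * (u.1 : A^c)) (v.1 : A^c)).
  exact: (linearP p).
exists (- g :: l), (pack_linear lq); split=> [h u [u1 u2]|y] /=.
  apply: (gradingD (gm_grading N)); last exact: gp.
  by rewrite -[h](addKr (- g)) opprK; apply: gm_homogM.
rewrite inE => /predU1P[->|/sp[v <-]].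
  by exists (free_gen A (- g) l); rewrite /= raddf0 addr0; apply: scale1r.
by exists (0, v); rewrite /= scale0r add0r.
Qed.

Lemma fin_gen_cover N : fin_gen N ->
  exists l (p : {linear free l -> N}),
    graded_hom p /\ forall y, exists x, p x = y.
Proof.
move=> [s hs].
(* the homogeneous components of the generators generate *)
have dec (x : N) : {r : seq N | (forall y, y \in r -> exists g, gm_homog g y) &
    x = \sum_(y <- r) y}.
  by apply: cid2; have [_ /(_ x)] := gm_grading N.
pose r := flatten [seq s2val (dec x) | x <- s].
have [y|l [p [gp sp]]] := @homog_seq_cover N r.
  by move=> /flatten_mapP[x xs]; apply: (s2valP (dec x)).
exists l, p; split=> // y.
have imS (I : eqType) (t : seq I) (F : I -> N) :
    (forall i, i \in t -> exists v, p v = F i) -> exists v, p v = \sum_(i <- t) F i.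
  elim: t => [|i t IHt] ht; first by exists 0; rewrite raddf0 big_nil.
  have [|v ev] := IHt; first by move=> j jt; apply: ht; rewrite inE jt orbT.
  have [|w ew] := ht i; first exact: mem_head.
  by exists (w + v); rewrite big_cons -ev -ew; apply: raddfD.
have [a ->] := hs y; apply: (imS) => i _.
have [v ev] : exists v, p v = s`_i.
  rewrite (s2valP' (dec s`_i)); apply: imS => z zs; apply: sp.
  by apply/flatten_mapP; exists s`_i => //; apply: mem_nth.
by exists ((a i : A^c) *: v); rewrite -ev; apply: linearZ.
Qed.

Hypothesis locA : graded_local A.

(** Nakayama's lemma for the family of the h(e_i), e_i the generators of F: the
    equation h f = h says that each h(e_j) is a combination of the h(e_i) with
    coefficients in J.  In the equation for the first generator e, the
    coefficient [c] of h(e) has degree 0 and lies in J, so 1 - c has an inverse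
    [u] and h(e) = h(w u), where w collects the other terms.  Substituting this
    in the other equations gives the same situation with one generator less. *)
Lemma free_nakayama l N (h : {linear free l -> N})
    (f : {linear free l -> free l}) :
  graded_hom f -> (forall x, in_radical (f x)) -> (forall x, h (f x) = h x) ->
  forall x, h x = 0.
Proof.
elim: l h f => [|d l IHl] h f gf rf hf; first by move=> x; rewrite (thinmx0 x) raddf0.
pose e := free_gen A d l; pose c : A := (f e).1; pose w := (f e).2.
have [hc hw] : homog 0 c /\ gm_homog (- d) w.
  by have [] := gf _ _ (homog_free_gen A d l); rewrite /= subrr.
have [rc rw] := rf e.
have [u [uc cu]] := invertible_1B locA hc rc.
have hu : homog 0 u.
  by rewrite -oppr0; apply: (homog_inverse _ uc cu); apply: homogB => //; apply: homog1.
have he : h e = free_inr h ((u : A^c) *: w).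
  have e1 : ((1 - c : A) : A^c) *: h e = free_inr h w.
    apply/eqP; rewrite scalerBl scale1r subr_eq addrC.
    by rewrite -[X in X == _]hf [X in X == _]free_linearE.
  have -> : free_inr h ((u : A^c) *: w) = (u : A^c) *: free_inr h w by apply: linearZ.
  by rewrite -e1 scalerA [(u : A^c) * _]uc scale1r.
(* what [f] becomes once h(e) is eliminated: e is replaced by w u *)
have lf' : linear (fun y : free l =>
    (((f (0, y)).1 : A) : A^c) *: ((u : A^c) *: w) + (f (0, y)).2 : free l).
  move=> r x y.
  have -> : f (0, r *: x + y) = r *: f (0, x) + f (0, y).
    rewrite -linearP; congr (f _).
    apply: (@injective_projections (gp_line A d) (free l)) => //=.
    by rewrite scaler0 addr0.
  by rewrite /= scalerDl -scalerA addrACA scalerDr.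
have h0 : forall y, free_inr h y = 0.
  apply: (IHl _ (pack_linear lf')) => [g y hy|y|y] /=.
  - have [|h1 h2] := gf g (0, y).
      by split=> //; apply: (grading0 (gm_grading (gp_line A d))).
    apply: (gradingD (gm_grading (free l))) => //.
    have := gm_homogM (gm_homogM hw hu) h1.
    by rewrite addr0 addKr.
  - apply: in_radicalD; last by have [] := rf (0, y).
    exact/in_radicalZ/in_radicalZ.
  - rewrite -[RHS](hf (0, y)) [RHS]free_linearE -/e he.
    exact: (linearP (free_inr h)).
move=> x; rewrite free_linearE -/e he h0 scaler0 add0r; exact: h0.
Qed.

Lemma in_radical_sum l (I : Type) (s : seq I) (F : I -> free l) :
  (forall i, in_radical (F i)) -> in_radical (\sum_(i <- s) F i).
Proof.
move=> hF; elim/big_ind: _ => //; [exact: in_radical0|exact: in_radicalD].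
Qed.

(** A relation with an invertible coefficient makes one generator redundant. *)
Lemma cover_shrink l (P : gradedModule A) (p : {linear free l -> P}) g v :
  graded_hom p -> (forall y, exists x, p x = y) ->
  gm_homog g v -> p v = 0 -> ~ in_radical v ->
  exists l' (q : {linear free l' -> P}), [/\ size l = (size l').+1, graded_hom q
    & forall y, exists x, q x = y].
Proof.
move=> gp sp hv pv nv.
have [b [l' [pl [k [k' [gk gk' kK kK' [c [kc _]]]]]]]] := free_exchange hv nv.
pose q := free_inr (p \o k'); exists l', q; split=> [||y].
- by rewrite (perm_size pl).
- move=> h x hx; apply/gp/gk'; split=> //.
  exact: (grading0 (gm_grading (gp_line A b))).
(* the redundant generator, expressed through the others *)
have e1 : p (k' (free_gen A b l')) = q (- ((c : A^c) *: (k v).2)).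
  have e2 : ((k v).1 : A^c) *: p (k' (free_gen A b l')) = - q (k v).2.
    apply/eqP; rewrite -addr_eq0 -[X in _ == X]pv -[in X in _ == X](kK v).
    by rewrite -[X in _ == X]/((p \o k') (k v)) [X in _ == X]free_linearE.
  have -> : q (- ((c : A^c) *: (k v).2)) = (c : A^c) *: - q (k v).2.
    by rewrite -scalerN -[- q _]raddfN; apply: linearZ.
  by rewrite -e2 scalerA [(c : A^c) * _]kc scale1r.
have [x <-] := sp y.
exists ((((k x).1 : A) : A^c) *: - ((c : A^c) *: (k v).2) + (k x).2).
rewrite -[in RHS](kK x) -[RHS]/((p \o k') (k x)) [RHS]free_linearE [in RHS]/= e1.
exact: (linearP q).
Qed.

(** With [s] a section of [p], the map f = 1 - s p projects onto ker p, so its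
    image lies in F J by the hypothesis on homogeneous elements, applied to
    components.  Nakayama's lemma with h = f, which is legitimate as f f = f,
    gives f = 0. *)
Lemma minimal_cover_iso l (P : gradedProj A) (p : {linear free l -> P}) :
  graded_hom p -> (forall y, exists x, p x = y) ->
  (forall g v, gm_homog g v -> p v = 0 -> in_radical v) ->
  graded_iso P (free l).
Proof.
move=> gp sp rp.
have [//|s gs ps] := @gp_projective _ _ P (free l) P p idfun gp _ sp.
pose f : {linear free l -> free l} := idfun \- (s \o p).
have pf x : p (f x) = 0 by rewrite /f /= raddfB /= ps subrr.
have gf : graded_hom f.
  move=> g x hx; apply: (gradingB (gm_grading (free l))) => //.
  exact/gs/gp.
have rf x : in_radical (f x).
  have [t [F [_ hF ->]]] := grading_decomp (gm_grading (free l)) x.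
  rewrite raddf_sum; apply: in_radical_sum => g.
  by apply: (rp g); [apply/gf/hF|apply: pf].
have f0 : forall x, f x = 0.
  apply: (free_nakayama gf rf) => x.
  by rewrite {1}/f /= pf raddf0 subr0.
by exists s, p; split=> // x; apply/esym/eqP; rewrite -subr_eq0; apply/eqP/f0.
Qed.

(** Existence of the decomposition: generators are removed from a graded
    surjection until [minimal_cover_iso] applies. *)
Theorem projective_free (P : gradedProj A) : exists l, graded_iso P (free l).
Proof.
have [l [p [gp sp]]] := fin_gen_cover (gp_fin_gen P).
have [n] := ubnP (size l); elim: n l p gp sp => // n IHn l p gp sp ln.
have [[g [v [hv pv nv]]]|np] :=
  pselect (exists g v, [/\ gm_homog g v, p v = 0 & ~ in_radical v]).
  have [l' [q [sl gq sq]]] := cover_shrink gp sp hv pv nv.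
  by apply: (IHn l' q) => //; rewrite -ltnS -sl.
exists l; apply: (minimal_cover_iso gp sp) => g v hv pv.
by apply: contrapT => nv; apply: np; exists g, v.
Qed.

End Existence.

(** * The isomorphism *)

Section Rank.
Variables (G : zmodType) (A : gradedRing G).
Implicit Types C D : isoclass A.
Hypothesis locA : graded_local A.

Local Notation class := (\pi_(Quotient.quot (unit_support A))).

Definition line_class (d : G) : isoclass A := isoclass_of (gp_line A d).

Lemma isoclass_free l : isoclass_of (gp_free A l) = \sum_(d <- l) line_class d.
Proof.
elim: l => [|d l IHl]; first by rewrite big_nil.
by rewrite big_cons -IHl; apply/esym/isoclass_addE.
Qed.

Lemma isoclass_lines C : exists l, C = \sum_(d <- l) line_class d.
Proof.
have [P ->] := isoclass_of_surj C; have [l Pl] := projective_free locA P.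
by exists l; rewrite -isoclass_free; apply/isoclass_of_eq.
Qed.

Lemma lines_perm l m :
  \sum_(d <- l) line_class d = \sum_(d <- m) line_class d ->
  perm_eq (map class l) (map class m).
Proof.
by rewrite -!isoclass_free => /isoclass_of_eq; apply: free_iso_perm.
Qed.

Lemma eq_line_class a b : class a = class b -> line_class a = line_class b.
Proof. by move=> /eq_class ab; apply/isoclass_of_eq/line_iso. Qed.

Lemma shift_line_class g d : isoclass_shift g (line_class d) = line_class (g + d).
Proof.
rewrite isoclass_shiftE; apply/isoclass_of_eq/graded_iso_sym.
exact: gshiftA.
Qed.

Lemma isoclass_shift_zero g : isoclass_shift g (0 : isoclass A) = 0.
Proof.
rewrite [LHS]isoclass_shiftE; apply/isoclass_of_eq.
exact: (@graded_isoP _ _ (gshift g (gzero A)) (gzero A) id id).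
Qed.

Lemma shift_lines g l :
  isoclass_shift g (\sum_(d <- l) line_class d) = \sum_(d <- l) line_class (g + d).
Proof.
rewrite (big_morph _ (isoclass_shiftD g) (isoclass_shift_zero g)).
by apply: eq_bigr => d _; apply: shift_line_class.
Qed.

Definition class_basis (d : G) : zgr_quot (unit_support A) := << class d >>.

(** The decomposition is an arbitrary choice; [rank_lines] shows that the result
    does not depend on it. *)
Definition rank (C : isoclass A) : zgr_quot (unit_support A) :=
  \sum_(d <- projT1 (cid (isoclass_lines C))) class_basis d.

Lemma rank_lines l :
  rank (\sum_(d <- l) line_class d) = \sum_(d <- l) class_basis d.
Proof.
rewrite /rank; case: cid => m /= /lines_perm lm.
rewrite -!(big_map class xpredT (fun c => << c >> : zgr_quot _)).
by apply: perm_big; rewrite perm_sym.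
Qed.

Lemma rankD : {morph rank : C D / C + D}.
Proof.
move=> C D; have [l ->] := isoclass_lines C; have [m ->] := isoclass_lines D.
by rewrite -big_cat !rank_lines big_cat.
Qed.

Lemma rank_shift g C : rank (isoclass_shift g C) = zgr_quot_act g (rank C).
Proof.
have [l ->] := isoclass_lines C.
rewrite shift_lines -(big_map (+%R g) xpredT line_class) !rank_lines big_map.
have act0 : zgr_quot_act g 0 = 0 :> zgr_quot (unit_support A).
  by apply: (addIr (zgr_quot_act g 0)); rewrite -zgr_quot_actD !add0r.
rewrite (big_morph _ (zgr_quot_actD g) act0); apply: eq_bigr => d _.
by rewrite /class_basis /zgr_quot_act zgr_shiftU -raddfD.
Qed.

(** The additive extension of [rank] to the group completion; [K0_rankE] is its
    independence of the representative. *)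
Definition K0_rank (u : K0gr A) : zgr_quot (unit_support A) :=
  rank (repr u).1 - rank (repr u).2.

Lemma K0_rankE C D : K0_rank (gsub C D) = rank C - rank D.
Proof.
have [k] := repr_gsub C D => /(congr1 rank); rewrite !rankD => /addIr e.
by apply/eqP; rewrite /K0_rank subr_eq addrAC -e addrK.
Qed.

Lemma K0_rankD : {morph K0_rank : u v / u + v}.
Proof.
move=> u v; have [C [D ->]] := gsub_surj u; have [E [F ->]] := gsub_surj v.
by rewrite [X in K0_rank X]gsubD !K0_rankE !rankD opprD addrACA.
Qed.

Lemma K0_rank_shift g u : K0_rank (K0gr_shift g u) = zgr_quot_act g (K0_rank u).
Proof.
have [C [D ->]] := gsub_surj u; rewrite /K0gr_shift.
rewrite gcompl_mapE; last exact: isoclass_shiftD.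
apply/eqP; rewrite !K0_rankE !rank_shift subr_eq -zgr_quot_actD.
by rewrite subrK.
Qed.

(** For additive maps, linearity over Z[Gamma] is compatibility with the action
    of the basis elements, that is, with shifts. *)
Lemma K0_rank_linear : linear K0_rank.
Proof.
move=> r u v; rewrite K0_rankD; congr (_ + _); move: r.
apply: fg_ext => [r s|r s|g].
- by rewrite [X in K0_rank X]scalerDl K0_rankD.
- by apply: scalerDl.
rewrite [X in K0_rank X]zgr_scaleU [RHS]zgr_scaleU; exact: K0_rank_shift.
Qed.

Definition K0_of_basis (x : zgr_quot (unit_support A)) : K0gr A :=
  fgext (fun c => gclass (line_class (repr c))) x.

Lemma line_class_repr d : line_class (repr (class d)) = line_class d.
Proof. by apply: eq_line_class; rewrite reprK. Qed.

Lemma K0_of_basisD : {morph K0_of_basis : x y / x + y}.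
Proof. exact: fgextD. Qed.

Lemma rank_line d : rank (line_class d) = class_basis d.
Proof. by have := rank_lines [:: d]; rewrite !big_seq1. Qed.

Lemma rank0 : rank 0 = 0.
Proof. by have := rank_lines [::]; rewrite !big_nil. Qed.

Lemma K0_of_basisK : cancel K0_of_basis K0_rank.
Proof.
apply: fg_ext => [x y|//|c]; first by rewrite K0_of_basisD K0_rankD.
rewrite /K0_of_basis fgextU mulr1z K0_rankE rank0 subr0 rank_line.
by rewrite /class_basis reprK.
Qed.

Lemma gclassD : {morph @gclass (isoclass A) : C D / C + D}.
Proof. by move=> C D; rewrite [RHS]gsubD addr0. Qed.

Lemma gsub_addl C D : gsub C D + gclass D = gclass C.
Proof. by rewrite [LHS]gsubD; apply/gsubP; exists 0; rewrite !addr0. Qed.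

Lemma K0_of_basis_rank C : K0_of_basis (rank C) = gclass C.
Proof.
have [l ->] := isoclass_lines C; rewrite rank_lines.
rewrite [LHS]fgext_sum [RHS](big_morph _ gclassD (erefl 0)).
by apply: eq_bigr => d _; rewrite fgextU mulr1z line_class_repr.
Qed.

Lemma K0_rankK : cancel K0_rank K0_of_basis.
Proof.
move=> u; have [C [D ->]] := gsub_surj u; apply: (addIr (gclass D)).
rewrite [RHS]gsub_addl -[X in _ + X]K0_of_basis_rank -K0_of_basisD K0_rankE subrK.
exact: K0_of_basis_rank.
Qed.

End Rank.

Theorem proposition3p8p3 (G : zmodType) (A : gradedRing G) :
  graded_local A ->
  exists phi : {linear K0gr A -> zgr_quot (unit_support A)}, bijective phi.
Proof.
move=> locA; exists (pack_linear (K0_rank_linear locA)).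
by exists (@K0_of_basis G A); [apply: K0_rankK|apply: K0_of_basisK].
Qed.
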